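(* Let $(R,f,g)$ be a commutative Krasner $(m,n)$-hyperring with nonzero scalar identity $1$, and let $\{P_i\}_{i\in I}$ be a family of $n$-ary $wsq$-primary hyperideals of $R$ none of which is $n$-ary $sq$-primary. Then $P=\bigcap_{i\in I}P_i$ is an $n$-ary $wsq$-primary hyperideal of $R$.
   Context: Families are indexed by a nonempty set. Notation: $m,n\ge 2$; $a_i^j$ denotes the sequence $a_i,a_{i+1},\dots,a_j$ (empty if $j<i$), and $a^{(k)}$ denotes $a$ repeated $k$ times. An $m$-ary hyperoperation $f$ on $R$ assigns to every $m$-tuple a nonempty subset of $R$ (a singleton is identified with its element). For nonempty subsets, $f(A_1^m)=\bigcup\{f(a_1^m): a_i\in A_i\}$ and $g(A_1^n)=\{g(a_1^n): a_i\in A_i\}$; an element $x$ in an argument stands for $\{x\}$. A canonical $m$-ary hypergroup $(R,f)$: $f$ is associative and commutative; there is a unique $0\in R$ with $f(x,0^{(m-1)})=\{x\}$ for all $x$; each $x$ has a unique $-x$ with $0\in f(x,-x,0^{(m-2)})$; and $x\in f(x_1^m)$ implies $x_i\in f(x,-x_1,\dots,-x_{i-1},-x_{i+1},\dots,-x_m)$ for each $i$. A Krasner $(m,n)$-hyperring $(R,f,g)$: $(R,f)$ is a canonical $m$-ary hypergroup, $g:R^n\to R$ is associative ($n$-ary semigroup), $g$ is distributive over $f$ in each argument, i.e. $g(a_1^{i-1},f(x_1^m),a_{i+1}^n)=f(g(a_1^{i-1},x_1,a_{i+1}^n),\dots,g(a_1^{i-1},x_m,a_{i+1}^n))$, and $0$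 is absorbing for $g$. Commutative means $g$ is symmetric in its arguments; a scalar identity $1$ satisfies $g(x,1^{(n-1)})=x$ for all $x$. A hyperideal of $R$ is a nonempty $I\subseteq R$ that is an $m$-ary subhypergroup of $(R,f)$ (closed under $f$ and under $x\mapsto -x$) with $g(a_1^{i-1},I,a_{i+1}^n)\subseteq I$ for all $a_1^n\in R$ and all $i$. A proper hyperideal $Q$ is ($n$-ary) prime if $g(a_1^n)\in Q$ with $a_1^n\in R$ implies $a_i\in Q$ for some $i$. The radical $\mathbf{r}^{(m,n)}(I)$ of a hyperideal $I$ is the intersection of all prime hyperideals containing $I$ (equal to $R$ if there are none). A proper hyperideal $P$ is $n$-ary $sq$-primary (strongly quasi-primary) if for all $r_1^n\in R$, $g(r_1^n)\in P$ implies $g(r_i^{(2)},1^{(n-2)})\in P$ or $g(r_1^{i-1},1,r_{i+1}^n)\in \mathbf{r}^{(m,n)}(P)$ for some $1\le i\le n$. It is $n$-ary $wsq$-primary (weakly strongly quasi-primary) if for all $r_1^n\in R$, $0\ne g(r_1^n)\in P$ implies $g(r_i^{(2)},1^{(n-2)})\in P$ or $g(r_1^{i-1},1,r_{i+1}^n)\in \mathbf{r}^{(m,n)}(P)$ for some $1\le i\le n$. *)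

(* Defs.v *)
From mathcomp Require Import all_boot perm.
From mathcomp Require Import boolp classical_sets.

Set Implicit Arguments.
Unset Strict Implicit.
Unset Printing Implicit Defensive.

Local Open Scope classical_set_scope.

(* A k-tuple (a_1, ..., a_k) is a function a : 'I_k -> T, so the paper's index
   i in {1, ..., k} is the ordinal i - 1. *)
Section Tuples.
Context {T : Type} {k : nat}.

(* The entries of s followed by copies of d, up to length k. *)
Definition pad (d : T) (s : seq T) : 'I_k -> T := fun j => nth d s j.

(* (a_1^{i-1}, x, a_{i+1}^k) *)
Definition upd (a : 'I_k -> T) (i : 'I_k) (x : T) : 'I_k -> T :=
  fun j => if j == i then x else a j.

(* (a_1^{i-1}, x, a_{k+i}^{2k-1}); only the first 2k-1 terms of a matter. *)
Definition splice (a : nat -> T) (i : 'I_k) (x : T) : 'I_k -> T :=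
  fun j => if j < i then a j else if j == i then x else a (j + k.-1).

(* a_i^{k+i-1} *)
Definition window (a : nat -> T) (i : 'I_k) : 'I_k -> T := fun j => a (i + j).

(* (x, h a_1, ..., h a_{i-1}, h a_{i+1}, ..., h a_k) *)
Definition transpose (h : T -> T) (x : T) (a : 'I_k -> T) (i : 'I_k) :
    'I_k -> T :=
  pad x (x :: [seq h (a j) | j <- enum 'I_k & j != i]).

End Tuples.

Definition hyperlift {T : Type} {m : nat} (f : ('I_m -> T) -> set T)
    (A : 'I_m -> set T) : set T :=
  \bigcup_(a in [set a : 'I_m -> T | forall i, A i (a i)]) f a.

Record canonical_hypergroup {T : Type} {m : nat} (f : ('I_m -> T) -> set T)
    (zero : T) (opp : T -> T) : Prop := CanonicalHypergroup {
  hadd_nonempty : forall a, f a !=set0;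
  hadd_assoc : forall (a : nat -> T) (i j : 'I_m),
    hyperlift f (splice (fun l => [set a l]) i (f (window a i))) =
    hyperlift f (splice (fun l => [set a l]) j (f (window a j)));
  hadd_comm : forall a (s : {perm 'I_m}), f (a \o s) = f a;
  hadd_zero : forall x, f (pad zero [:: x]) = [set x];
  hadd_zero_unique : forall e,
    (forall x, f (pad e [:: x]) = [set x]) -> e = zero;
  hadd_opp : forall x, f (pad zero [:: x; opp x]) zero;
  hadd_opp_unique : forall x y, f (pad zero [:: x; y]) zero -> y = opp x;
  hadd_reversible : forall x a (i : 'I_m),
    f a x -> f (transpose opp x a i) (a i)
}.

Record krasner_hyperring (m n : nat) := KrasnerHyperring {
  carrier :> Type;
  hadd : ('I_m -> carrier) -> set carrier;
  hmul : ('I_n -> carrier) -> carrier;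
  hzero : carrier;
  hopp : carrier -> carrier;
  hadd_canonical : canonical_hypergroup hadd hzero hopp;
  hmul_assoc : forall (a : nat -> carrier) (i j : 'I_n),
    hmul (splice a i (hmul (window a i))) =
    hmul (splice a j (hmul (window a j)));
  hmul_distr : forall (a : 'I_n -> carrier) (i : 'I_n) (x : 'I_m -> carrier),
    [set hmul (upd a i y) | y in hadd x] = hadd (fun l => hmul (upd a i (x l)));
  hmul_zero : forall (a : 'I_n -> carrier) (i : 'I_n),
    hmul (upd a i hzero) = hzero
}.

Arguments hadd {m n k} : rename.
Arguments hmul {m n k} : rename.
Arguments hzero {m n k} : rename.
Arguments hopp {m n k} : rename.

Section Hyperrings.
Context {m n : nat} (R : krasner_hyperring m n).

Definition commutative_hyperring : Prop :=
  forall (a : 'I_n -> R) (s : {perm 'I_n}), hmul (a \o s) = hmul a.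

Definition scalar_identity (e : R) : Prop :=
  forall x : R, hmul (pad e [:: x]) = x.

Record hyperideal (J : set R) : Prop := Hyperideal {
  hyperideal_nonempty : J !=set0;
  hyperideal_hadd : forall a : 'I_m -> R, (forall i, J (a i)) -> hadd a `<=` J;
  hyperideal_opp : forall x, J x -> J (hopp x);
  hyperideal_hmul : forall (a : 'I_n -> R) (i : 'I_n) (x : R),
    J x -> J (hmul (upd a i x))
}.

Definition prime_hyperideal (Q : set R) : Prop :=
  [/\ hyperideal Q, Q <> [set: R] &
      forall a : 'I_n -> R, Q (hmul a) -> exists i, Q (a i)].

(* The intersection of an empty family of subsets of R is R. *)
Definition radical (J : set R) : set R :=
  \bigcap_(Q in [set Q | prime_hyperideal Q /\ J `<=` Q]) Q.

(* g(r_i^{(2)}, 1^{(n-2)}) in P or g(r_1^{i-1}, 1, r_{i+1}^n) in the radical *)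
Definition sq_condition (one : R) (P : set R) (r : 'I_n -> R) (i : 'I_n) :
    Prop :=
  P (hmul (pad one [:: r i; r i])) \/ radical P (hmul (upd r i one)).

Definition sq_primary (one : R) (P : set R) : Prop :=
  [/\ hyperideal P, P <> [set: R] &
      forall r : 'I_n -> R, P (hmul r) -> exists i, sq_condition one P r i].

Definition wsq_primary (one : R) (P : set R) : Prop :=
  [/\ hyperideal P, P <> [set: R] &
      forall r : 'I_n -> R, hmul r <> hzero -> P (hmul r) ->
        exists i, sq_condition one P r i].

End Hyperrings.

(* Main.v *)
Require Import Defs.
From mathcomp Require Import all_boot perm.
From mathcomp Require Import boolp classical_sets.

(** Write [N] for the intersection of all prime hyperideals and [x + y] for the
    set [f(x, y, 0, .., 0)].  The key fact is
    that a wsq-primary hyperideal [P] that is not sq-primary lies in [N]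
    ([wsq_not_sq_nil]), so that its radical is [N] itself.

    Indeed, there is a tuple [b] with [g(b)] in [P] that violates the
    sq-condition at every index.  For [p] in [P], replacing an entry [b_i] by an
    element [c] of [b_i + p] changes nothing modulo [P], so the new tuple again
    violates the condition everywhere and has its product in [P].  Weakness of
    the sq-condition says that all these products are [0].  Since
    [g(.., c, ..)] belongs to [g(.., b_i, ..) + g(.., p, ..)], vanishing of
    the first two products forces that of the third, and by induction any set
    of entries of [b] can be replaced by [p] with product [0].  Replacing all
    the entries gives [g(p, .., p) = 0], whence [p] lies in every prime.

    Now let [g(r)] be a nonzero element of the intersection [P] of the family,
    and fix one member [P_j].  It satisfies the sq-condition at some [i].
    Either [g(r_1^{i-1}, 1, r_{i+1}^n)] is in the radical of [P_j], which is
    [N], hence contained in the radical of [P]; or [g(r_i, r_i, 1, .., 1)] is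
    in [P_j], hence in every prime, so [r_i] is in every prime too and the
    product of [r] with [1] put at an index [k] other than [i], which still has
    the factor [r_i], is in [N].  In both cases the radical alternative of the
    sq-condition holds for the intersection, and one member of the family is
    enough to find the index. *)

Local Open Scope classical_set_scope.

(** * Tuples *)

Section Tuples.
Context {T : Type} {k : nat}.

Lemma upd_id (a : 'I_k -> T) (i : 'I_k) : upd a i (a i) = a.
Proof. by apply/funext => j; rewrite /upd; case: eqP => [->|]. Qed.

Lemma upd_upd (a : 'I_k -> T) (i : 'I_k) (x y : T) :
  upd (upd a i x) i y = upd a i y.
Proof. by apply/funext => j; rewrite /upd; case: eqP. Qed.

Lemma upd_comm (a : 'I_k -> T) (i j : 'I_k) (x y : T) : i != j ->
  upd (upd a i x) j y = upd (upd a j y) i x.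
Proof.
move=> ij; apply/funext => l; rewrite /upd.
by case: (eqVneq l j) => [->|//]; rewrite eq_sym (negbTE ij).
Qed.

Lemma upd_pad (d : T) (s : seq T) (i : 'I_k) (x : T) :
  upd (pad d s) i x = pad d (set_nth d s i x).
Proof. by apply/funext => j; rewrite /upd /pad nth_set_nth. Qed.

Lemma exists_other_index (i : 'I_k) : (2 <= k)%N -> exists j : 'I_k, j != i.
Proof.
move=> hk; case: (posnP i) => hi; last first.
  by exists (Ordinal (ltnW hk)); rewrite -val_eqE /= eq_sym -lt0n.
by exists (Ordinal hk); rewrite -val_eqE /= hi.
Qed.

End Tuples.

Section Hyperring.
Context {m n : nat} (hm : (2 <= m)%N) (hn : (2 <= n)%N).
Context (R : krasner_hyperring m n).

(** * Binary sums *)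

Definition hadd2 (x y : R) : set R := hadd (pad hzero [:: x; y]).

Lemma hadd2_0x (y : R) : hadd2 hzero y = [set y].
Proof.
have H := hadd_canonical R.
rewrite -(hadd_zero H) -(hadd_comm H _ (tperm (Ordinal (ltnW hm)) (Ordinal hm))).
congr hadd; apply/funext => j; rewrite /comp /pad.
case: tpermP => [->|->|/eqP + /eqP] //=.
by case: j => [[|[|j]] hj] //=; rewrite nth_nil.
Qed.

Lemma hmul_hadd2 (x : 'I_n -> R) (i : 'I_n) (b p c : R) : hadd2 b p c ->
  hadd2 (hmul (upd x i b)) (hmul (upd x i p)) (hmul (upd x i c)).
Proof.
move=> hc; rewrite /hadd2.
suff -> : pad hzero [:: hmul (upd x i b); hmul (upd x i p)] =
    (fun l : 'I_m => hmul (upd x i (pad hzero [:: b; p] l))).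
  by rewrite -hmul_distr; exists c.
by apply/funext => -[[|[|l]] hl] //=; rewrite /pad /= !nth_nil hmul_zero.
Qed.

(** * Hyperideals *)

(** The zero element is a product having both a factor in [J] and a factor
    [0]; two distinct positions are available because [2 <= n]. *)
Lemma hyperideal0 (J : set R) : hyperideal J -> J hzero.
Proof.
move=> hJ; have [x Jx] := hyperideal_nonempty hJ.
pose i : 'I_n := Ordinal hn; have [k ki] := exists_other_index i hn.
have := hyperideal_hmul hJ (upd (fun=> x) k hzero) i Jx.
by rewrite upd_comm // hmul_zero.
Qed.

Lemma hyperideal_factor (J : set R) (a : 'I_n -> R) (i : 'I_n) :
  hyperideal J -> J (a i) -> J (hmul a).
Proof. by move=> hJ Ja; rewrite -(upd_id a i); apply: hyperideal_hmul. Qed.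

Lemma hyperideal_bigcap (I : Type) (P : I -> set R) :
  (forall i, hyperideal (P i)) -> hyperideal (\bigcap_i P i).
Proof.
move=> hP; split.
- by exists hzero => i _; apply: hyperideal0.
- move=> a ha x ax i _; apply: (hyperideal_hadd (hP i) _ ax) => l.
  exact: ha.
- by move=> x hx i _; apply: hyperideal_opp => //; apply: hx.
- by move=> a i x hx j _; apply: hyperideal_hmul => //; apply: hx.
Qed.

Lemma hyperideal_add (J : set R) (x : 'I_n -> R) (i : 'I_n) (b p c : R) :
  hyperideal J -> J p -> hadd2 b p c ->
  J (hmul (upd x i b)) -> J (hmul (upd x i c)).
Proof.
move=> hJ Jp hc Jb.
apply: (hyperideal_hadd hJ _ (hmul_hadd2 x i _ _ _ hc)) => -[[|[|l]] hl] //=.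
  exact: hyperideal_hmul.
by rewrite /pad /= nth_nil; apply: hyperideal0.
Qed.

(** Reversibility writes [b] as an element of [c - p], so that the two
    multiples differ by a multiple of [p]. *)
Lemma hyperideal_sub (J : set R) (x : 'I_n -> R) (i : 'I_n) (b p c : R) :
  hyperideal J -> J p -> hadd2 b p c ->
  J (hmul (upd x i c)) -> J (hmul (upd x i b)).
Proof.
move=> hJ Jp hc Jc.
pose i0 : 'I_m := Ordinal (ltnW hm).
have hb := hadd_reversible (hadd_canonical R) i0 hc.
have : [set hmul (upd x i y) |
    y in hadd (transpose hopp c (pad hzero [:: b; p]) i0)] (hmul (upd x i b)).
  by exists b.
rewrite hmul_distr; apply: hyperideal_hadd => // l.
(* The entries of this tuple are [c], [- p] and opposites of [0]. *)
suff [-> //|Jl] : transpose hopp c (pad hzero [:: b; p]) i0 l = c \/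
    J (transpose hopp c (pad hzero [:: b; p]) i0 l).
  exact: hyperideal_hmul.
rewrite /transpose /pad; case: (nat_of_ord l) => [|l'] /=; first by left.
case: (ltnP l' (size [seq j <- enum 'I_m | j != i0])) => hl; last first.
  by left; rewrite nth_default // size_map.
right; rewrite (nth_map i0) //.
have := mem_nth i0 hl; rewrite mem_filter => /andP[+ _].
case: (nth i0 _ l') => [[|[|j]] hj] //= _; first exact: hyperideal_opp.
by rewrite nth_nil; apply: hyperideal_opp => //; apply: hyperideal0.
Qed.

(** * Scalar identity and prime hyperideals *)

Context (one : R) (hone : scalar_identity one).

Lemma hyperideal_one (J : set R) : hyperideal J -> J one -> J = [set: R].
Proof.
move=> hJ J1; apply/seteqP; split=> // x _; rewrite -(hone x).
by apply: (hyperideal_factor _ _ (Ordinal hn)).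
Qed.

Lemma prime_square (Q : set R) (x : R) : prime_hyperideal Q ->
  Q (hmul (pad one [:: x; x])) -> Q x.
Proof.
case=> hQ Qproper Qprime /Qprime [[[|[|k]] hk]] //=.
by rewrite /pad /= nth_nil => /(hyperideal_one _ hQ).
Qed.

(** * Weakly strongly quasi-primary hyperideals *)

(** A tuple violating the sq-condition at every index still does so after one
    entry is moved by an element of [P]: membership in [P], and in each prime
    containing [P], is insensitive to such a move. *)
Lemma sq_condition_mod (P : set R) (b : 'I_n -> R) (i j : 'I_n) (p c : R) :
  hyperideal P -> P p -> hadd2 (b i) p c ->
  sq_condition one P (upd b i c) j -> sq_condition one P b j.
Proof.
move=> hP Pp hc [hsq|hrad]; [left|right].
- (* If [i = j], the square of [c] becomes that of [b i] one factor at a time. *)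
  move: hsq; rewrite {1 2}/upd; case: eqP => [->|//].
  pose i0 : 'I_n := Ordinal (ltnW hn); pose i1 : 'I_n := Ordinal hn.
  have -> : pad one [:: c; c] = upd (pad one [:: c; c]) i0 c.
    by rewrite upd_pad.
  move/(hyperideal_sub _ _ _ _ _ _ hP Pp hc); rewrite upd_pad /=.
  have -> : pad one [:: b i; c] = upd (pad one [:: b i; c]) i1 c.
    by rewrite upd_pad.
  by move/(hyperideal_sub _ _ _ _ _ _ hP Pp hc); rewrite upd_pad.
- move=> Q [Qprime PQ]; have := hrad Q (conj Qprime PQ).
  have [-> | ij] := eqVneq i j; first by rewrite upd_upd.
  case: Qprime => hQ _ _.
  rewrite upd_comm // => /(hyperideal_sub _ _ _ _ _ _ hQ (PQ _ Pp) hc).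
  by rewrite upd_comm 1?eq_sym // upd_id.
Qed.

(** The induction is on the list [s] of replaced positions, with [b] kept
    general: the induction hypothesis serves for [b] and for [b] moved at the
    position to be added. *)
Lemma hmul_replace_eq0 (P : set R) (p : R) (s : seq 'I_n) (b : 'I_n -> R) :
  wsq_primary one P -> P p -> P (hmul b) ->
  (forall j, ~ sq_condition one P b j) ->
  hmul (fun j => if j \in s then p else b j) = hzero.
Proof.
move=> [hP _ hw] Pp; elim: s b => [|i s IHs] b Pb bad.
  by apply: contrapT => /hw /(_ Pb) [j /bad].
set bs := fun j => if j \in s then p else b j.
have bs0 : hmul bs = hzero by apply: IHs.
have -> : (fun j => if j \in i :: s then p else b j) = upd bs i p.
  by apply/funext => j; rewrite /upd inE; case: eqP.
have [si|si] := boolP (i \in s).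
  by have -> : p = bs i; [rewrite /bs si|rewrite upd_id].
have [c hc] : hadd2 (b i) p !=set0 := hadd_nonempty (hadd_canonical R) _.
have Pc : P (hmul (upd b i c)).
  by apply: hyperideal_add hP Pp hc _; rewrite upd_id.
have cs0 : hmul (upd bs i c) = hzero.
  rewrite -(IHs _ Pc) => [|j /(sq_condition_mod _ _ _ _ _ _ hP Pp hc)]; last first.
    exact: bad.
  congr hmul; apply/funext => j; rewrite /upd /bs.
  by case: (eqVneq j i) => // ->; rewrite (negbTE si).
have := hmul_hadd2 bs i _ _ _ hc.
have -> : b i = bs i by rewrite /bs (negbTE si).
by rewrite upd_id bs0 cs0 hadd2_0x => /esym.
Qed.

Lemma wsq_not_sq_nil (P Q : set R) : wsq_primary one P -> ~ sq_primary one P ->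
  prime_hyperideal Q -> P `<=` Q.
Proof.
move=> hw hns [hQ _ Qprime] p Pp; have [hP Pproper _] := hw.
have [b [Pb bad]] : exists b, P (hmul b) /\ forall j, ~ sq_condition one P b j.
  apply: contrapT => nobad; apply: hns; split=> // b Pb.
  apply: contrapT => nsq; apply: nobad; exists b; split=> // j bj.
  by apply: nsq; exists j.
have := hmul_replace_eq0 _ p (enum 'I_n) b hw Pp Pb bad.
have -> : (fun j => if j \in enum 'I_n then p else b j) = (fun=> p).
  by apply/funext => j; rewrite mem_enum.
move=> p0; have [] // := Qprime (fun=> p).
by rewrite p0; apply: hyperideal0.
Qed.

End Hyperring.

(** * Intersections *)

Theorem theorem4p6 (m n : nat) (hm : (2 <= m)%N) (hn : (2 <= n)%N)
    (R : krasner_hyperring m n) (hcomm : commutative_hyperring R)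
    (one : R) (hone : scalar_identity one) (hone0 : one <> hzero)
    (I : Type) (hI : [set: I] !=set0) (P : I -> set R)
    (hwsq : forall i, wsq_primary one (P i))
    (hnsq : forall i, ~ sq_primary one (P i)) :
  wsq_primary one (\bigcap_i P i).
Proof.
have nil j Q : prime_hyperideal Q -> P j `<=` Q.
  exact: (wsq_not_sq_nil hm hn R one).
have [j _] := hI; have [_ Pj_proper Pj_wsq] := hwsq j; split.
- by apply: (hyperideal_bigcap hn) => i; case: (hwsq i).
- move=> full; apply: Pj_proper; apply/seteqP; split=> // x _.
  by have : [set: R] x by []; rewrite -full; apply.
- move=> r r0 Pr; have [i [sq_i|rad_i]] := Pj_wsq r r0 (Pr j Logic.I).
    have [k ki] := exists_other_index i hn.
    exists k; right=> Q [Qprime _].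
    have Qri : Q (r i).
      exact: (prime_square hn R one hone _ _ Qprime (nil j Q Qprime _ sq_i)).
    have [hQ _ _] := Qprime; apply: (hyperideal_factor _ _ _ i hQ).
    by rewrite /upd eq_sym (negbTE ki).
  by exists i; right=> Q [Qprime _]; apply: rad_i; split; last exact: nil.
Qed.
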